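(* Let $\mathcal{U}\in \mathbb{C}^{I_1\times\cdots\times I_M \times J_1\times\cdots\times J_N }$, $\mathcal{V}\in \mathbb{C}^{J_1\times\cdots\times J_N \times K_1\times\cdots\times K_L }$ and $\mathcal{W}\in \mathbb{C}^{K_1\times\cdots\times K_L \times H_1\times\cdots\times H_R}$. Let $\mathcal{M} \in \mathbb{C}^{I_1\times\cdots\times I_M \times I_1 \times\cdots\times I_M}$ and $\mathcal{N} \in \mathbb{C}^{H_1\times\cdots\times H_R \times H_1 \times\cdots\times H_R}$ be a pair of Hermitian positive definite tensors. Then: (a) $(\mathcal{U}*_N\mathcal{V}*_L\mathcal{W})_{\mathcal{M},\mathcal{N}}^{\dagger} = [(\mathcal{U}_{\mathcal{M},\mathcal{I}_N}^{\dagger})^{*}*_N\mathcal{V}*_L\mathcal{W}]_{\mathcal{M}^{-1},\mathcal{N}}^{\dagger}*_M(\mathcal{U}_{\mathcal{M},\mathcal{I}_N}^{\dagger})^{*}*_N\mathcal{V}*_L(\mathcal{W}_{\mathcal{I}_L,\mathcal{N}}^{\dagger})^{*}*_R[\mathcal{U}*_N\mathcal{V}*_L(\mathcal{W}_{\mathcal{I}_L,\mathcal{N}}^{\dagger})^{*}]_{\mathcal{M},\mathcal{N}^{-1}}^{\dagger}$; (b) $(\mathcal{U}*_N\mathcal{V}*_L\mathcal{W})_{\mathcal{M},\mathcal{N}}^{\dagger} = [\{(\mathcal{U}*_N\mathcal{V})_{\mathcal{M},\mathcal{I}_L}^{\dagger}\}^{*}*_L\mathcal{W}]_{\mathcal{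M}^{-1},\mathcal{N}}^{\dagger}*_M[(\mathcal{U}*_N\mathcal{V})_{\mathcal{M},\mathcal{I}_L}^{\dagger}]^{*}*_L\mathcal{V}^{\dagger}*_N[(\mathcal{V}*_L\mathcal{W})_{\mathcal{I}_N,\mathcal{N}}^{\dagger}]^{*}*_R[\mathcal{U}*_N\{(\mathcal{V}*_L\mathcal{W})_{\mathcal{I}_N,\mathcal{N}}^{\dagger}\}^{*}]_{\mathcal{M},\mathcal{N}^{-1}}^{\dagger}$.
   Context: Einstein product: for $\mathcal{A}\in\mathbb{C}^{I_1\times\cdots\times I_M\times J_1\times\cdots\times J_N}$ and $\mathcal{B}\in\mathbb{C}^{J_1\times\cdots\times J_N\times K_1\times\cdots\times K_L}$, $(\mathcal{A}*_N\mathcal{B})_{i_1\ldots i_Mk_1\ldots k_L}=\sum_{j_1,\ldots,j_N}a_{i_1\ldots i_Mj_1\ldots j_N}b_{j_1\ldots j_Nk_1\ldots k_L}$ (the subscript is the number of contracted indices; similarly $*_M,*_L,*_R$). The conjugate transpose $\mathcal{A}^*$ has entries $(\mathcal{A}^* )_{j_1\ldots j_Ni_1\ldots i_M}=\overline{a_{i_1\ldots i_Mj_1\ldots j_N}}$. $\mathcal{I}_N$ and $\mathcal{I}_L$ are the identity tensors of $\mathbb{C}^{J_1\times\cdots\times J_N\times J_1\times\cdots\times J_N}$ and $\mathbb{C}^{K_1\times\cdots\times K_L\times K_1\times\cdots\times K_L}$ (entries: products of Kronecker deltas); inverses of tensors with the same row and column index sets are with respect to the Einstein product. A tensor $\mathcal{P}$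 with the same row and column index sets is Hermitian positive definite if $\mathcal{P}=\mathcal{Z}*\mathcal{D}*\mathcal{Z}^*$ (Einstein products over all the row indices) with $\mathcal{Z}$ unitary ($\mathcal{Z}*\mathcal{Z}^*=\mathcal{Z}^**\mathcal{Z}$ is the identity tensor) and $\mathcal{D}$ a diagonal tensor with positive diagonal entries. Weighted Moore-Penrose inverse: for $\mathcal{A}\in\mathbb{C}^{I_1\times\cdots\times I_M\times J_1\times\cdots\times J_N}$ and Hermitian positive definite $\mathcal{M}\in\mathbb{C}^{I_1\times\cdots\times I_M\times I_1\times\cdots\times I_M}$, $\mathcal{N}\in\mathbb{C}^{J_1\times\cdots\times J_N\times J_1\times\cdots\times J_N}$, $\mathcal{A}^\dagger_{\mathcal{M},\mathcal{N}}$ is the unique $\mathcal{Y}\in\mathbb{C}^{J_1\times\cdots\times J_N\times I_1\times\cdots\times I_M}$ with $\mathcal{A}*_N\mathcal{Y}*_M\mathcal{A}=\mathcal{A}$, $\mathcal{Y}*_M\mathcal{A}*_N\mathcal{Y}=\mathcal{Y}$, $(\mathcal{M}*_M\mathcal{A}*_N\mathcal{Y})^*=\mathcal{M}*_M\mathcal{A}*_N\mathcal{Y}$, $(\mathcal{N}*_N\mathcal{Y}*_M\mathcal{A})^*=\mathcal{N}*_N\mathcal{Y}*_M\mathcal{A}$; the same definition applies with other index sets. The Moore-Penrose inverse $\mathcal{A}^\dagger$ is the case where both weights are identity tensors. *)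

(* Defs.v *)
From HB Require Import structures.
From mathcomp Require Import all_boot all_order all_algebra.
From mathcomp Require Import boolp classical_sets reals.
From mathcomp Require Import complex.
Set Implicit Arguments.
Unset Strict Implicit.
Unset Printing Implicit Defensive.
Import Order.TTheory GRing.Theory Num.Theory.
Local Open Scope ring_scope.
Local Open Scope complex_scope.

(* The multi-indices (i_1, ..., i_m) with i_k ranging over d k values. *)
Definition midx (m : nat) (d : 'I_m -> nat) :=
  {dffun forall k : 'I_m, 'I_(d k)}.

(* C^{I_1 x ... x I_m x J_1 x ... x J_n}. The type records where the index list
   is split into row and column indices, which is what the conjugate transpose
   and the Einstein product depend on. *)
Definition tensor (R : realType) (m n : nat) (I : 'I_m -> nat)
  (J : 'I_n -> nat) := {ffun midx I * midx J -> R[i]}.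

Definition einstein (R : realType) (m n l : nat) (I : 'I_m -> nat)
    (J : 'I_n -> nat) (K : 'I_l -> nat)
    (A : tensor R I J) (B : tensor R J K) : tensor R I K :=
  [ffun p : midx I * midx K => \sum_(j : midx J) A (p.1, j) * B (j, p.2)].

Definition ctrans (R : realType) (m n : nat) (I : 'I_m -> nat)
    (J : 'I_n -> nat) (A : tensor R I J) : tensor R J I :=
  [ffun p : midx J * midx I => conjc (A (p.2, p.1))].

Declare Scope tensor_scope.
Delimit Scope tensor_scope with T.
(* As in print, a chain A *e B *e C parses to the left. *)
Notation "A *e B" := (einstein A B)
  (at level 40, left associativity) : tensor_scope.
Notation "A ^H" := (ctrans A) (at level 2, format "A ^H") : tensor_scope.
Local Open Scope tensor_scope.

Definition idT (R : realType) (n : nat) (J : 'I_n -> nat) : tensor R J J :=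
  [ffun p : midx J * midx J => \prod_(k < n) (p.1 k == p.2 k)%:R].
Arguments idT R {n} J.

Definition is_inverse (R : realType) (n : nat) (J : 'I_n -> nat)
    (A X : tensor R J J) : Prop :=
  A *e X = idT R J /\ X *e A = idT R J.

(* Such an X is unique when it exists; the value is 0 when A is singular. *)
Definition invT (R : realType) (n : nat) (J : 'I_n -> nat)
    (A : tensor R J J) : tensor R J J :=
  xget (0 : tensor R J J) [set X : tensor R J J | is_inverse A X].

Definition unitaryT (R : realType) (n : nat) (J : 'I_n -> nat)
    (Z : tensor R J J) : Prop :=
  Z *e Z^H = idT R J /\ Z^H *e Z = idT R J.

Definition diagonalT (R : realType) (n : nat) (J : 'I_n -> nat)
    (D : tensor R J J) : Prop :=
  forall i j : midx J, i <> j -> D (i, j) = 0.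

(* In the order of R[i], 0 < z means that z is real and positive. *)
Definition hpd (R : realType) (n : nat) (J : 'I_n -> nat)
    (P : tensor R J J) : Prop :=
  exists Z D : tensor R J J,
    [/\ unitaryT Z, diagonalT D, (forall i : midx J, 0 < D (i, i))
      & P = Z *e D *e Z^H].

Definition is_wpinv (R : realType) (m n : nat) (I : 'I_m -> nat)
    (J : 'I_n -> nat) (M : tensor R I I) (N : tensor R J J)
    (A : tensor R I J) (Y : tensor R J I) : Prop :=
  [/\ A *e Y *e A = A,
      Y *e A *e Y = Y,
      (M *e A *e Y)^H = M *e A *e Y
    & (N *e Y *e A)^H = N *e Y *e A].

(* For Hermitian positive definite M and N there is exactly one such Y;
   otherwise the value is some solution, or 0 if there is none. *)
Definition wpinv (R : realType) (m n : nat) (I : 'I_m -> nat)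
    (J : 'I_n -> nat) (M : tensor R I I) (N : tensor R J J)
    (A : tensor R I J) : tensor R J I :=
  xget (0 : tensor R J I) [set Y : tensor R J I | is_wpinv M N A Y].

Definition pinv (R : realType) (m n : nat) (I : 'I_m -> nat)
    (J : 'I_n -> nat) (A : tensor R I J) : tensor R J I :=
  wpinv (idT R I) (idT R J) A.

(* Main.v *)
(* Flattening multi-indices turns tensors into matrices, Einstein products into
   matrix products and Hermitian positive definite tensors into definite
   Hermitian matrices. For such weights the weighted inverse exists, by a
   full-rank factorization. Let [Y] be the weighted inverse of [A], and let [B],
   [C] have the same null space, respectively the same range, as [A]. If [X] and
   [Z] are weighted inverses of [B] and [C], then [Y *m A = X *m B] and
   [A *m Y = C *m Z], since a projection that is self-adjoint for a
   nondegenerate Hermitian form is determined by its null space or by its range.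
   When [C = A *m T], this gives [Y = Y *m A *m Y = X *m B *m T *m Z]. Both
   identities are of this form, with [T = Q *m Q^*], where [Q] is the weighted
   inverse of [W] in (a) and of [V *e W] in (b). *)
Require Import Defs.
From HB Require Import structures.
From mathcomp Require Import all_boot all_order all_algebra.
From mathcomp Require Import reals.
From mathcomp Require Import classical_sets complex.
Set Implicit Arguments.
Unset Strict Implicit.
Unset Printing Implicit Defensive.
Import Order.TTheory GRing.Theory Num.Theory.
Local Open Scope ring_scope.
Local Open Scope sesquilinear_scope.

(** * Nondegenerate Hermitian forms over matrices *)

Section WeightedInverseMatrix.
Context {C : numClosedFieldType}.

Lemma adjmxM m n p (A : 'M[C]_(m, n)) (B : 'M[C]_(n, p)) :
  (A *m B)^t* = B^t* *m A^t*.
Proof. by rewrite trmx_mul map_mxM. Qed.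

Lemma adjmx1 n : (1%:M : 'M[C]_n)^t* = 1%:M.
Proof. by rewrite trmx1 map_mx1. Qed.

Lemma adjmx_inv n (P : 'M[C]_n) : (invmx P)^t* = invmx (P^t*).
Proof. by rewrite trmx_inv map_invmx. Qed.

(* Positive or negative definite: the sign of the form plays no role. *)
Definition hdefmx n (P : 'M[C]_n) :=
  P^t* = P /\ forall x : 'rV_n, x *m P *m x^t* = 0 -> x = 0.

Lemma hdefmx_unit n (P : 'M[C]_n) : hdefmx P -> P \in unitmx.
Proof.
case=> _ P0; rewrite -row_free_unit; apply/inj_row_free => x xP0.
by apply: P0; rewrite xP0 mul0mx.
Qed.

(** The form of [P] is pulled back along [x |-> x *m G], which is injective when [G] is row free. *)
Lemma hdefmx_gram m n (P : 'M[C]_n) (G : 'M[C]_(m, n)) :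
  hdefmx P -> row_free G -> hdefmx (G *m P *m G^t*).
Proof.
move=> [PH P0] Gfree; split; first by rewrite !adjmxM trmxCK PH mulmxA.
move=> x xG; apply: (row_free_inj Gfree); rewrite mul0mx; apply: P0.
by rewrite adjmxM !mulmxA in xG *.
Qed.

Lemma hdefmx_inv n (P : 'M[C]_n) : hdefmx P -> hdefmx (invmx P).
Proof.
move=> hP; have PU := hdefmx_unit hP; have [PH _] := hP.
(* This exhibits the inverse as a pullback of [P] itself. *)
have -> : invmx P = invmx P *m P *m (invmx P)^t*.
  by rewrite mulVmx // mul1mx adjmx_inv PH.
by apply: hdefmx_gram; rewrite // row_free_unit unitmx_inv.
Qed.

Lemma hdefmx_diag n (D : 'M[C]_n) :
  (forall i j, i != j -> D i j = 0) -> (forall i, 0 < D i i) -> hdefmx D.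
Proof.
move=> Doff Dpos; split.
  apply/matrixP=> i j; rewrite !mxE; have [->|ij] := eqVneq i j.
    by apply/CrealP; rewrite gtr0_real.
  by rewrite !Doff ?conjC0 // eq_sym.
move=> x /matrixP/(_ 0 0); rewrite !mxE => xDx.
have xD j : (x *m D) 0 j = x 0 j * D j j.
  rewrite mxE (bigD1 j) //= big1 ?addr0 // => k kj.
  by rewrite Doff ?mulr0.
(* A sum of nonnegative terms vanishes only termwise. *)
have xDxE : \sum_j D j j * `|x 0 j| ^+ 2 = 0.
  rewrite -[RHS]xDx; apply: eq_bigr => j _.
  by rewrite xD !mxE normCK mulrAC mulrC.
apply/rowP=> j; rewrite !mxE; apply/eqP.
have /eqP := xDxE; rewrite psumr_eq0 => [/allP/(_ j)|k _]; last first.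
  by rewrite mulr_ge0 ?exprn_ge0 // ltW.
by rewrite mem_index_enum mulf_eq0 gt_eqF //= sqrf_eq0 normr_eq0; apply.
Qed.

Lemma hdefmx1 n : hdefmx (1%:M : 'M[C]_n).
Proof.
apply: hdefmx_diag => [i j ij|i]; rewrite mxE ?eqxx ?ltr01 //.
by rewrite (negPf ij).
Qed.

(** * Weighted inverses of matrices: existence and the associated projections *)

Definition wpinvmx m n (M : 'M[C]_m) (N : 'M[C]_n) (A : 'M[C]_(m, n))
    (Y : 'M[C]_(n, m)) :=
  [/\ A *m Y *m A = A, Y *m A *m Y = Y,
      (M *m A *m Y)^t* = M *m A *m Y & (N *m Y *m A)^t* = N *m Y *m A].

Lemma wpinvmx_exists m n (M : 'M[C]_m) (N : 'M[C]_n) (A : 'M[C]_(m, n)) :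
  hdefmx M -> hdefmx N -> exists Y, wpinvmx M N A Y.
Proof.
move=> hM hN; have NU := hdefmx_unit hN.
have [[MH _] [NH _]] := (hM, hN).
have [r [F [G [AE Ffree Gfree]]]] : exists r (F : 'M_(m, r)) (G : 'M_(r, n)),
    [/\ A = F *m G, row_free (F^t*) & row_free G].
  exists (\rank A), (col_base A), (row_base A).
  rewrite mulmx_base row_base_free /row_free mxrank_map mxrank_tr.
  by split=> //; exact: col_base_full.
have hG := hdefmx_gram (hdefmx_inv hN) Gfree.
have hF := hdefmx_gram hM Ffree.
rewrite trmxCK in hF.
have [[FH _] [GH _]] := (hF, hG).
have FU := hdefmx_unit hF; have GU := hdefmx_unit hG.
set KF := F^t* *m M *m F in FH FU hF.
set KG := G *m invmx N *m G^t* in GH GU hG.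
(* A weighted right inverse of [G], namely [invmx N *m G^t* *m invmx KG], followed by a weighted
   left inverse of [F], namely [invmx KF *m F^t* *m M]. *)
pose Y := invmx N *m G^t* *m invmx KG *m invmx KF *m F^t* *m M.
have AY : A *m Y = F *m invmx KF *m F^t* *m M.
  rewrite AE /Y !mulmxA -[F *m G *m invmx N]mulmxA -[F *m _ *m G^t*]mulmxA.
  by rewrite -/KG mulmxK.
have YA : Y *m A = invmx N *m G^t* *m invmx KG *m G.
  rewrite AE /Y !mulmxA -[_ *m F^t* *m M]mulmxA -[_ *m (F^t* *m M) *m F]mulmxA.
  by rewrite -/KF mulmxKV.
exists Y; split.
- rewrite AY AE mulmxA -[_ *m F^t* *m M]mulmxA -[_ *m (F^t* *m M) *m F]mulmxA.
  by rewrite -/KF mulmxKV.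
- rewrite YA /Y !mulmxA -[_ *m G *m invmx N]mulmxA.
  by rewrite -[_ *m (G *m invmx N) *m G^t*]mulmxA -/KG mulmxKV.
- by rewrite -mulmxA AY !adjmxM adjmx_inv trmxCK MH FH !mulmxA.
- rewrite -mulmxA YA !mulmxA mulmxV // mul1mx.
  by rewrite !adjmxM adjmx_inv trmxCK GH !mulmxA.
Qed.

(** The last two hypotheses say that [E] and [F] are projections with the same null space.
    Self-adjointness moves [N] across: [N E = N E F = E^t* N F = E^t* F^t* N = F^t* N = N F]. *)
Lemma hdefmx_proj_ker n (N E F : 'M[C]_n) :
    hdefmx N -> (N *m E)^t* = N *m E -> (N *m F)^t* = N *m F ->
  E *m F = E -> F *m E = F -> E = F.
Proof.
move=> hN NE NF EF FE; have NU := hdefmx_unit hN.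
have [NH _] := hN; rewrite !adjmxM NH in NE NF.
apply: (can_inj (mulKmx NU)).
by rewrite -{1}EF mulmxA -NE -mulmxA -NF mulmxA -adjmxM FE.
Qed.

(** The dual statement, for projections with the same range. *)
Lemma hdefmx_proj_im n (M E F : 'M[C]_n) :
    hdefmx M -> (M *m E)^t* = M *m E -> (M *m F)^t* = M *m F ->
  F *m E = E -> E *m F = F -> E = F.
Proof.
move=> hM ME MF FE EF; have MU := hdefmx_unit hM.
have [MH _] := hM; rewrite !adjmxM MH in ME MF.
apply: (can_inj (mulKmx MU)).
by rewrite -ME -{1}FE adjmxM -mulmxA MF mulmxA ME -mulmxA EF.
Qed.

(** * Factoring a weighted inverse through matrices with the same null space or range *)

Section ThreeFactor.
Variables (m n p q : nat) (M : 'M[C]_m) (N : 'M[C]_n).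
Variables (M' : 'M[C]_p) (N' : 'M[C]_q).
Variables (A : 'M[C]_(m, n)) (B : 'M[C]_(p, n)) (D : 'M[C]_(m, q)).
Variables (Y : 'M[C]_(n, m)) (X : 'M[C]_(n, p)) (Z : 'M[C]_(q, m)).

(** The multipliers [S], [S'] witness that [A] and [B] have the same null space; [T], [T'] witness
    that [A] and [D] have the same range. *)
Lemma wpinvmx_factor (S : 'M[C]_(p, m)) (S' : 'M[C]_(m, p))
    (T : 'M[C]_(n, q)) (T' : 'M[C]_(q, n)) :
    hdefmx M -> hdefmx N -> wpinvmx M N A Y -> wpinvmx M' N B X ->
    wpinvmx M N' D Z ->
    B = S *m A -> A = S' *m B -> D = A *m T -> A = D *m T' ->
  Y = X *m B *m T *m Z.
Proof.
move=> hM hN [AYA YAY MAY NYA] [BXB _ _ NXB] [DZD _ MDZ _] BA AB DA AD.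
have AXB : A *m X *m B = A by rewrite {1}AB -!(mulmxA S') BXB -AB.
have BYA : B *m Y *m A = B by rewrite {1}BA -!(mulmxA S) AYA -BA.
have DZA : D *m Z *m A = A by rewrite {1}AD mulmxA DZD -AD.
have AYD : A *m Y *m D = D by rewrite {1}DA mulmxA AYA -DA.
have YX : Y *m A = X *m B.
  by apply: (hdefmx_proj_ker hN); rewrite -?mulmxA ?(mulmxA A) ?(mulmxA B) ?AXB
    ?BYA ?mulmxA.
have YZ : A *m Y = D *m Z.
  by apply: (hdefmx_proj_im hM); rewrite ?mulmxA ?AYD ?DZA.
(* [X B T Z = Y A T Z = Y D Z = Y A Y = Y]. *)
by rewrite -YX -[_ *m A *m T]mulmxA -DA -mulmxA -YZ mulmxA YAY.
Qed.

End ThreeFactor.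

Section InverseAdjoint.
Variables (m n : nat) (M : 'M[C]_m) (N : 'M[C]_n).
Variables (A : 'M[C]_(m, n)) (Y : 'M[C]_(n, m)).

(** With identity weight on the right [Y *m A] is Hermitian, so [Y^t*] and [A] are left multiples of
    each other and share their null space. *)
Lemma wpinvmx_adjr : wpinvmx M 1%:M A Y ->
  Y^t* = Y^t* *m Y *m A /\ A = A *m A^t* *m Y^t*.
Proof.
case=> AYA YAY _; rewrite mul1mx => YA; split.
  by rewrite -{1}YAY adjmxM YA mulmxA.
by rewrite -mulmxA -adjmxM YA mulmxA.
Qed.

(** Dually, [A *m Y] is Hermitian, so [Y^t*] and [A] share their range. *)
Lemma wpinvmx_adjl : wpinvmx 1%:M N A Y ->
  Y^t* = A *m Y *m Y^t* /\ A = Y^t* *m A^t* *m A.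
Proof.
case=> AYA YAY; rewrite mul1mx => AY _; split.
  by rewrite -{1}YAY -mulmxA adjmxM AY.
by rewrite -adjmxM AY.
Qed.

End InverseAdjoint.

Lemma wpinvmx_mul3 m n k h (M : 'M[C]_m) (N : 'M[C]_h)
    (M' : 'M[C]_m) (N' : 'M[C]_h)
    (U : 'M[C]_(m, n)) (V : 'M[C]_(n, k)) (W : 'M[C]_(k, h))
    (P : 'M[C]_(n, m)) (Q : 'M[C]_(h, k))
    (X : 'M[C]_(h, m)) (Y : 'M[C]_(h, m)) (Z : 'M[C]_(h, m)) :
    hdefmx M -> hdefmx N ->
    wpinvmx M N (U *m V *m W) Y ->
    wpinvmx M 1%:M U P -> wpinvmx 1%:M N W Q ->
    wpinvmx M' N (P^t* *m V *m W) X -> wpinvmx M N' (U *m V *m Q^t*) Z ->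
  Y = X *m P^t* *m V *m Q^t* *m Z.
Proof.
move=> hM hN hY /wpinvmx_adjr[PE UE] /wpinvmx_adjl[QE WE] hX hZ.
have := wpinvmx_factor (S := P^t* *m P) (S' := U *m U^t*)
  (T := Q *m Q^t*) (T' := W^t* *m W) hM hN hY hX hZ.
move=> ->; first by rewrite {2}QE !mulmxA.
- by rewrite {1}PE !mulmxA.
- by rewrite {1}UE !mulmxA.
- by rewrite {1}QE !mulmxA.
- by rewrite {1}WE !mulmxA.
Qed.

(** Here [G] stands for the Moore-Penrose inverse of [V]. As [P^t*] is a left multiple of [U *m V]
    and [Q^t*] a right multiple of [V *m W], the middle product contains [V *m G *m V], which
    collapses to [V]. *)
Lemma wpinvmx_mul3_pairs m n k h (M : 'M[C]_m) (N : 'M[C]_h)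
    (M' : 'M[C]_m) (N' : 'M[C]_h)
    (U : 'M[C]_(m, n)) (V : 'M[C]_(n, k)) (W : 'M[C]_(k, h))
    (G : 'M[C]_(k, n)) (P : 'M[C]_(k, m)) (Q : 'M[C]_(h, n))
    (X : 'M[C]_(h, m)) (Y : 'M[C]_(h, m)) (Z : 'M[C]_(h, m)) :
    hdefmx M -> hdefmx N ->
    wpinvmx M N (U *m V *m W) Y ->
    V *m G *m V = V ->
    wpinvmx M 1%:M (U *m V) P -> wpinvmx 1%:M N (V *m W) Q ->
    wpinvmx M' N (P^t* *m W) X -> wpinvmx M N' (U *m Q^t*) Z ->
  Y = X *m P^t* *m G *m Q^t* *m Z.
Proof.
move=> hM hN hY VGV /wpinvmx_adjr[PE UVE] /wpinvmx_adjl[QE VWE] hX hZ.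
have PGQ : P^t* *m G *m Q^t* = P^t* *m W *m (Q *m Q^t*).
  by rewrite {1}PE {1}QE {2}PE !mulmxA -!(mulmxA (_ *m _ *m U)) VGV.
have := wpinvmx_factor (S := P^t* *m P) (S' := U *m V *m (U *m V)^t*)
  (T := Q *m Q^t*) (T' := (V *m W)^t* *m (V *m W)) hM hN hY hX hZ.
move=> ->.
- by rewrite -[X *m _ *m G]mulmxA -[X *m _ *m Q^t*]mulmxA PGQ !mulmxA.
- by rewrite {1}PE !mulmxA.
- by rewrite {1}UVE !mulmxA.
- by rewrite {1}QE !mulmxA.
- by rewrite -{1}[U *m V *m W]mulmxA {1}VWE !mulmxA.
Qed.

End WeightedInverseMatrix.

Local Open Scope tensor_scope.
Local Open Scope complex_scope.

(** * Transfer from tensors to matrices *)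

Section Flattening.
Context {R : realType}.

Definition mxT m n (I : 'I_m -> nat) (J : 'I_n -> nat) (A : tensor R I J) :
    'M[R[i]]_(#|{: midx I}|, #|{: midx J}|) :=
  \matrix_(i, j) A (enum_val i, enum_val j).

Definition tensor_mx m n (I : 'I_m -> nat) (J : 'I_n -> nat)
    (X : 'M[R[i]]_(#|{: midx I}|, #|{: midx J}|)) : tensor R I J :=
  [ffun p => X (enum_rank p.1) (enum_rank p.2)].

Lemma tensor_mxK m n (I : 'I_m -> nat) (J : 'I_n -> nat) :
  cancel (@tensor_mx m n I J) (@mxT m n I J).
Proof. by move=> X; apply/matrixP=> i j; rewrite mxE ffunE !enum_valK. Qed.

Lemma mxT_inj m n (I : 'I_m -> nat) (J : 'I_n -> nat) :
  injective (@mxT m n I J).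
Proof.
move=> A B /matrixP AB; apply/ffunP=> -[i j].
by have := AB (enum_rank i) (enum_rank j); rewrite !mxE !enum_rankK.
Qed.

Lemma mxT_einstein m n l (I : 'I_m -> nat) (J : 'I_n -> nat) (K : 'I_l -> nat)
    (A : tensor R I J) (B : tensor R J K) : mxT (A *e B) = mxT A *m mxT B.
Proof.
apply/matrixP=> i k; rewrite !mxE ffunE /= (reindex _ (onW_bij _ (enum_val_bij _))).
by apply: eq_bigr => j _; rewrite !mxE.
Qed.

Lemma mxT_ctrans m n (I : 'I_m -> nat) (J : 'I_n -> nat) (A : tensor R I J) :
  mxT A^H = (mxT A)^t*.
Proof. by apply/matrixP=> i j; rewrite !mxE ffunE. Qed.

Lemma mxT_idT n (J : 'I_n -> nat) : mxT (idT R J) = 1%:M.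
Proof.
apply/matrixP=> i j; rewrite !mxE ffunE /=; have [->|ij] := eqVneq i j.
  by rewrite big1 // => k _; rewrite eqxx.
(* Distinct multi-indices differ in some component, whose Kronecker delta kills the product. *)
have /existsP[k kP] : [exists k, enum_val i k != enum_val j k].
  apply: contraNT ij => /existsPn eqij; apply/eqP/enum_val_inj/ffunP => k.
  exact/eqP/negPn/eqij.
by rewrite (bigD1 k) //= (negPf kP) mul0r.
Qed.

Lemma hdefmx_hpd n (J : 'I_n -> nat) (P : tensor R J J) :
  hpd P -> hdefmx (mxT P).
Proof.
case=> Z [D [[ZZ _] Doff Dpos ->]]; rewrite !mxT_einstein mxT_ctrans.
apply: hdefmx_gram.
  apply: hdefmx_diag => [i j ij|i]; rewrite mxE //.
  by apply: Doff => /enum_val_inj/eqP; rewrite (negPf ij).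
(* Unitarity makes the flattened [Z] invertible, hence row free. *)
move/(congr1 (@mxT _ _ _ _)): ZZ; rewrite mxT_einstein mxT_ctrans mxT_idT.
by move=> /mulmx1_unit[]; rewrite row_free_unit.
Qed.

Lemma mxT_invT n (J : 'I_n -> nat) (P : tensor R J J) :
  mxT P \in unitmx -> mxT (invT P) = invmx (mxT P).
Proof.
move=> PU; have [PX _] : is_inverse P (invT P).
  (* The unflattened matrix inverse is a witness, so the choice in [invT] returns a genuine
     inverse. *)
  apply: xgetPex; exists (tensor_mx (invmx (mxT P))).
  by split; apply: mxT_inj; rewrite mxT_einstein tensor_mxK mxT_idT ?mulmxV ?mulVmx.
move/(congr1 (@mxT _ _ _ _)): PX; rewrite mxT_einstein mxT_idT => PX.
by rewrite -[LHS](mulKmx PU) PX mulmx1.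
Qed.

(** Existence for matrices, carried back by [tensor_mx], ensures that [wpinv] returns a solution and
    not merely its default value. *)
Lemma mxT_wpinv m n (I : 'I_m -> nat) (J : 'I_n -> nat) (M : tensor R I I)
    (N : tensor R J J) (A : tensor R I J) :
    hdefmx (mxT M) -> hdefmx (mxT N) ->
  wpinvmx (mxT M) (mxT N) (mxT A) (mxT (wpinv M N A)).
Proof.
move=> hM hN; have [] : is_wpinv M N A (wpinv M N A).
  have [Y [AYA YAY MAY NYA]] := wpinvmx_exists (mxT A) hM hN.
  apply: xgetPex; exists (tensor_mx Y).
  by split; apply: mxT_inj; rewrite ?mxT_ctrans !mxT_einstein tensor_mxK.
by split; rewrite -!mxT_einstein -?mxT_ctrans; congr mxT.
Qed.

End Flattening.

Theorem theorem7 (R : realType) (m n l r : nat)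
    (I : 'I_m -> nat) (J : 'I_n -> nat) (K : 'I_l -> nat) (H : 'I_r -> nat)
    (U : tensor R I J) (V : tensor R J K) (W : tensor R K H)
    (M : tensor R I I) (N : tensor R H H) :
  hpd M -> hpd N ->
  wpinv M N (U *e V *e W) =
    wpinv (invT M) N ((wpinv M (idT R J) U)^H *e V *e W)
    *e (wpinv M (idT R J) U)^H *e V *e (wpinv (idT R K) N W)^H
    *e wpinv M (invT N) (U *e V *e (wpinv (idT R K) N W)^H)
  /\
  wpinv M N (U *e V *e W) =
    wpinv (invT M) N ((wpinv M (idT R K) (U *e V))^H *e W)
    *e (wpinv M (idT R K) (U *e V))^H *e pinv V
    *e (wpinv (idT R J) N (V *e W))^H
    *e wpinv M (invT N) (U *e (wpinv (idT R J) N (V *e W))^H).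
Proof.
move=> /hdefmx_hpd hM /hdefmx_hpd hN.
have hM' : hdefmx (mxT (invT M)).
  by rewrite mxT_invT ?hdefmx_unit //; apply: hdefmx_inv.
have hN' : hdefmx (mxT (invT N)).
  by rewrite mxT_invT ?hdefmx_unit //; apply: hdefmx_inv.
have h1 p (L : 'I_p -> nat) : hdefmx (mxT (idT R L)).
  by rewrite mxT_idT; apply: hdefmx1.
have hA := mxT_wpinv (U *e V *e W) hM hN.
rewrite !mxT_einstein in hA.
split; apply: mxT_inj; rewrite !mxT_einstein !mxT_ctrans.
  apply: (wpinvmx_mul3 hM hN hA).
  - by rewrite -(mxT_idT J); apply: mxT_wpinv.
  - by rewrite -(mxT_idT K); apply: mxT_wpinv.
  - by rewrite -mxT_ctrans -!mxT_einstein; apply: mxT_wpinv.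
  - by rewrite -mxT_ctrans -!mxT_einstein; apply: mxT_wpinv.
apply: (wpinvmx_mul3_pairs hM hN hA).
(* The first defining equation of [pinv V] provides [V *m G *m V = V]. *)
- by have [] := mxT_wpinv V (h1 _ J) (h1 _ K).
- by rewrite -(mxT_idT K) -mxT_einstein; apply: mxT_wpinv.
- by rewrite -(mxT_idT J) -mxT_einstein; apply: mxT_wpinv.
- by rewrite -mxT_ctrans -mxT_einstein; apply: mxT_wpinv.
- by rewrite -mxT_ctrans -mxT_einstein; apply: mxT_wpinv.
Qed.
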